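(* Let $R$ be a prime ring with extended centroid $C$, and let $K_1,\ldots,K_m$ be noncentral Lie ideals of $R$ with $m\geq 2$. Then $K_1K_2\cdots K_m$ contains a nonzero ideal of $R$ except when, for $1\leq j\leq m$, $K_1C=K_jC=Ca+C$ for any noncentral element $a\in K_1$. (That is: if it is not the case that $K_1C=K_jC=Ca+C$ for all $1\le j\le m$ and every $a\in K_1\setminus Z(R)$, then $K_1K_2\cdots K_m$ contains a nonzero ideal of $R$.)
   Context: Rings are associative, not necessarily with unity; ''ideal'' means two-sided ideal. $Z(R)$ is the center of $R$, and $[x,y]:=xy-yx$. For subsets $A,B$ of a ring, $[A,B]$ (resp. $AB$) denotes the additive subgroup generated by all $[x,y]$ (resp. $xy$) with $x\in A$, $y\in B$. A Lie ideal of $R$ is an additive subgroup $L$ with $[L,R]\subseteq L$; it is central if $L\subseteq Z(R)$, noncentral otherwise. $R$ is prime if $xRy=0$ implies $x=0$ or $y=0$. For $R$ prime, $Q_s(R)$ is the Martindale symmetric ring of quotients of $R$ (a prime ring containing $R$), and the extended centroid $C$ is the center of $Q_s(R)$, which is a field. $K_jC$ denotes the $C$-span of $K_j$ in $Q_s(R)$; $Ca+C=\{\beta a+\gamma:\beta,\gamma\in C\}$. *)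

(* Defs.v *)
From HB Require Import structures.
From mathcomp Require Import all_boot all_algebra generic_quotient.
From mathcomp Require Import boolp classical_sets.

Set Implicit Arguments.
Unset Strict Implicit.
Unset Printing Implicit Defensive.

Import GRing.Theory.
Local Open Scope classical_set_scope.
Local Open Scope ring_scope.
Local Open Scope quotient_scope.

(* The MathComp ring structures are all unital, hence a separate structure for
   associative rings in which no unit is assumed. *)
HB.mixin Record Zmodule_isRng R of GRing.Zmodule R := {
  rmul : R -> R -> R;
  rmulA : associative rmul;
  rmulDl : left_distributive rmul +%R;
  rmulDr : right_distributive rmul +%R
}.

#[short(type="rngType")]
HB.structure Definition Rng := {R of Zmodule_isRng R & GRing.Zmodule R}.

Reserved Notation "x ** y" (at level 40, left associativity).
Notation "x ** y" := (rmul x y) : ring_scope.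

(* The zero ring is excluded, as it has no nonzero ideal on which to define
   quotients.  A ring with a noncentral subset is nonzero anyway. *)
HB.mixin Record Rng_isPrime R of Rng R := {
  rprime : forall x y : R, (forall r, x ** r ** y = 0) -> x = 0 \/ y = 0;
  rnontrivial : exists x : R, x != 0
}.

#[short(type="primeRngType")]
HB.structure Definition PrimeRng := {R of Rng_isPrime R & Rng R}.

Section AdditiveSubgroups.
Variable V : zmodType.
Implicit Types A B : set V.

Definition addsubgroup A := A 0 /\ forall x y, A x -> A y -> A (x - y).

Definition addspan A : set V := smallest addsubgroup A.

Lemma addsubgroupN A x : addsubgroup A -> A x -> A (- x).
Proof. by move=> [A0 AB] Ax; rewrite -[- x]add0r; apply: AB. Qed.

Lemma addsubgroupD A x y : addsubgroup A -> A x -> A y -> A (x + y).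
Proof.
move=> sA Ax Ay; rewrite -[y]opprK; case: (sA) => _; apply=> //.
exact: addsubgroupN.
Qed.

Lemma addspan_subgroup A : addsubgroup (addspan A).
Proof.
split=> [B [[B0 _] _] //|x y Ax Ay B BP].
by case: (BP) => [[_ BB] _]; apply: BB; [apply: Ax|apply: Ay].
Qed.

Lemma sub_addspan A : A `<=` addspan A.
Proof. by move=> x Ax B [_]; apply. Qed.

Lemma addspan_min A B : addsubgroup B -> A `<=` B -> addspan A `<=` B.
Proof. by move=> sB AB x; apply. Qed.

End AdditiveSubgroups.

Section RngSets.
Variable R : rngType.
Implicit Types A B : set R.

Definition setmul A B : set R := addspan [set x ** y | x in A & y in B].

Definition setcomm A B : set R :=
  addspan [set x ** y - y ** x | x in A & y in B].

Definition setprod A (s : seq (set R)) : set R := foldl setmul A s.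

Definition center : set R := [set z | forall x, z ** x = x ** z].

Definition ideal A :=
  [/\ addsubgroup A, forall r x, A x -> A (r ** x)
    & forall x r, A x -> A (x ** r)].

Definition nzideal A := ideal A /\ exists2 x, A x & x != 0.

Definition lie_ideal A := addsubgroup A /\ setcomm A setT `<=` A.

Definition noncentral A := ~ (A `<=` center).

Lemma rmul0r (x : R) : 0 ** x = 0.
Proof. by apply: (@addIr _ (0 ** x)); rewrite -rmulDl !add0r. Qed.

Lemma rmulr0 (x : R) : x ** 0 = 0.
Proof. by apply: (@addIr _ (x ** 0)); rewrite -rmulDr !add0r. Qed.

Lemma rmulNr (x y : R) : (- x) ** y = - (x ** y).
Proof. by apply: (@addIr _ (x ** y)); rewrite -rmulDl !addNr rmul0r. Qed.

Lemma rmulrN (x y : R) : x ** (- y) = - (x ** y).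
Proof. by apply: (@addIr _ (x ** y)); rewrite -rmulDr !addNr rmulr0. Qed.

Lemma rmulBl (x y z : R) : (x - y) ** z = x ** z - y ** z.
Proof. by rewrite rmulDl rmulNr. Qed.

Lemma rmulBr (x y z : R) : x ** (y - z) = x ** y - x ** z.
Proof. by rewrite rmulDr rmulrN. Qed.

Lemma setmul_gen A B x y : A x -> B y -> setmul A B (x ** y).
Proof. by move=> Ax By; apply: sub_addspan; exists x => //; exists y. Qed.

Lemma ideal_setT : ideal (@setT R).
Proof. by split. Qed.

Lemma ideal_setmul A B : ideal A -> ideal B -> ideal (setmul A B).
Proof.
move=> [_ lA _] [_ _ rB]; have sAB : addsubgroup (setmul A B).
  exact: addspan_subgroup.
split=> // [r x|x r] ABx.
- suff : setmul A B `<=` [set z | setmul A B (r ** z)] by apply.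
  apply: addspan_min => [|z [a Aa [b Bb <-]] /=].
    split=> /= [|y z]; first by rewrite rmulr0; case: sAB.
    by rewrite rmulBr; case: sAB => _; apply.
  by rewrite rmulA; apply: setmul_gen => //; apply: lA.
- suff : setmul A B `<=` [set z | setmul A B (z ** r)] by apply.
  apply: addspan_min => [|z [a Aa [b Bb <-]] /=].
    split=> /= [|y z]; first by rewrite rmul0r; case: sAB.
    by rewrite rmulBl; case: sAB => _; apply.
  by rewrite -rmulA; apply: setmul_gen => //; apply: rB.
Qed.

Lemma setmul_subl A B : ideal A -> setmul A B `<=` A.
Proof.
by case=> sA _ rA; apply: addspan_min => // _ [a Aa [b _ <-]]; apply: rA.
Qed.

Lemma setmul_subr A B : ideal B -> setmul A B `<=` B.
Proof.
by case=> sB lB _; apply: addspan_min => // _ [a _ [b Bb <-]]; apply: lB.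
Qed.

Lemma idealI A B : ideal A -> ideal B -> ideal (A `&` B).
Proof.
move=> [[A0 sA] lA rA] [[B0 sB] lB rB]; split.
- by split=> // x y [Ax Bx] [Ay By]; split; [apply: sA|apply: sB].
- by move=> r x [Ax Bx]; split; [apply: lA|apply: lB].
- by move=> x r [Ax Bx]; split; [apply: rA|apply: rB].
Qed.

End RngSets.

Section PrimeRngTheory.
Variable R : primeRngType.
Implicit Types A B : set R.

Lemma nzideal_setT : nzideal (@setT R).
Proof.
split; first exact: ideal_setT.
by have [x x0] := @rnontrivial R; exists x.
Qed.

Lemma nzideal_setmul A B : nzideal A -> nzideal B -> nzideal (setmul A B).
Proof.
move=> [iA [a Aa a0]] [iB [b Bb b0]]; split; first exact: ideal_setmul.
have [//|nAB] := pselect (exists2 x, setmul A B x & x != 0).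
have ab0 r : a ** r ** b = 0.
  apply/eqP/negPn/negP => arb; case: nAB; exists (a ** r ** b) => //.
  by apply: setmul_gen => //; case: iA => _ _; apply.
by case/rprime: ab0 => e; move: a0 b0; rewrite e eqxx.
Qed.

Lemma nzidealI A B : nzideal A -> nzideal B -> nzideal (A `&` B).
Proof.
move=> nA nB; have [_ [x ABx x0]] := nzideal_setmul nA nB.
case: nA nB => iA _ [iB _]; split; first exact: idealI.
by exists x => //; split; [apply: setmul_subl ABx|apply: setmul_subr ABx].
Qed.

Lemma nzideal_annl A x : nzideal A -> (forall a, A a -> x ** a = 0) -> x = 0.
Proof.
move=> [[_ lA _] [a Aa a0]] xA.
have: forall r, x ** r ** a = 0 by move=> r; rewrite -rmulA xA //; apply: lA.
by case/rprime => // e; rewrite e eqxx in a0.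
Qed.

Lemma nzideal_annr A x : nzideal A -> (forall a, A a -> a ** x = 0) -> x = 0.
Proof.
move=> [[_ _ rA] [a Aa a0]] xA.
have: forall r, a ** r ** x = 0 by move=> r; rewrite xA //; apply: rA.
by case/rprime => // e; rewrite e eqxx in a0.
Qed.

End PrimeRngTheory.

(* A pair (f, g) on a nonzero ideal I: f : I -> R is a homomorphism of right
   R-modules, g : I -> R one of left R-modules, and g(x)y = xf(y).  Such a pair
   stands for the quotient q with qx = f(x) and xq = g(x) on I.  The values of
   f and g outside I are irrelevant, by the definition of germ_eq. *)
Record bimult_axiom (R : primeRngType) (I : set R) (f g : R -> R) : Prop := {
  bdomP_ : nzideal I;
  lactD_ : forall x y, I x -> I y -> f (x + y) = f x + f y;
  lactM_ : forall x r, I x -> f (x ** r) = f x ** r;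
  ractD_ : forall x y, I x -> I y -> g (x + y) = g x + g y;
  ractM_ : forall r x, I x -> g (r ** x) = r ** g x;
  bimultP_ : forall x y, I x -> I y -> g x ** y = x ** f y
}.

Record bimult (R : primeRngType) := Bimult {
  bdom : set R;
  lact : R -> R;
  ract : R -> R;
  bimult_ax : bimult_axiom bdom lact ract
}.

HB.instance Definition _ (R : primeRngType) := gen_eqMixin (bimult R).
HB.instance Definition _ (R : primeRngType) := gen_choiceMixin (bimult R).

Section BimultOps.
Variable R : primeRngType.
Implicit Types p q : bimult R.

Lemma bdomP p : nzideal (bdom p). Proof. exact: bdomP_ (bimult_ax p). Qed.
Lemma lactD p x y :
  bdom p x -> bdom p y -> lact p (x + y) = lact p x + lact p y.
Proof. exact: lactD_ (bimult_ax p) x y. Qed.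
Lemma lactM p x r : bdom p x -> lact p (x ** r) = lact p x ** r.
Proof. exact: lactM_ (bimult_ax p) x r. Qed.
Lemma ractD p x y :
  bdom p x -> bdom p y -> ract p (x + y) = ract p x + ract p y.
Proof. exact: ractD_ (bimult_ax p) x y. Qed.
Lemma ractM p r x : bdom p x -> ract p (r ** x) = r ** ract p x.
Proof. exact: ractM_ (bimult_ax p) r x. Qed.
Lemma bimultP p x y : bdom p x -> bdom p y -> ract p x ** y = x ** lact p y.
Proof. exact: bimultP_ (bimult_ax p) x y. Qed.

Definition germ_eq p q :=
  exists2 I : set R, nzideal I &
    forall x, I x -> [/\ bdom p x, bdom q x,
                         lact p x = lact q x & ract p x = ract q x].

Lemma bdom_ideal p : ideal (bdom p). Proof. by case: (bdomP p). Qed.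
Lemma bdom_sub p : addsubgroup (bdom p). Proof. by case: (bdom_ideal p). Qed.
Lemma bdom0 p : bdom p 0. Proof. by case: (bdom_sub p). Qed.
Lemma bdomD p x y : bdom p x -> bdom p y -> bdom p (x + y).
Proof. by move=> px py; apply: addsubgroupD (bdom_sub p) px py. Qed.
Lemma bdomN p x : bdom p x -> bdom p (- x).
Proof. by move=> px; apply: addsubgroupN (bdom_sub p) px. Qed.
Lemma bdomMl p r x : bdom p x -> bdom p (r ** x).
Proof. by case: (bdom_ideal p) => _ l _; apply: l. Qed.
Lemma bdomMr p x r : bdom p x -> bdom p (x ** r).
Proof. by case: (bdom_ideal p) => _ _; apply. Qed.

Lemma lact0 p : lact p 0 = 0.
Proof. by rewrite -{1}(@rmulr0 R 0) lactM ?rmulr0 //; apply: bdom0. Qed.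
Lemma ract0 p : ract p 0 = 0.
Proof. by rewrite -{1}(@rmulr0 R 0) ractM ?rmul0r //; apply: bdom0. Qed.
Lemma lactN p x : bdom p x -> lact p (- x) = - lact p x.
Proof.
move=> px; apply: (@addIr _ (lact p x)).
by rewrite -lactD ?addNr ?lact0 //; apply: bdomN.
Qed.
Lemma ractN p x : bdom p x -> ract p (- x) = - ract p x.
Proof.
move=> px; apply: (@addIr _ (ract p x)).
by rewrite -ractD ?addNr ?ract0 //; apply: bdomN.
Qed.

Lemma germ_eq_refl p : germ_eq p p.
Proof. by exists (bdom p) => //; apply: bdomP. Qed.

Lemma germ_eq_sym p q : germ_eq p q -> germ_eq q p.
Proof. by case=> I nI H; exists I => // x /H []. Qed.

Lemma germ_eq_trans p q r : germ_eq p q -> germ_eq q r -> germ_eq p r.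
Proof.
move=> [I nI HI] [J nJ HJ]; exists (I `&` J); first exact: nzidealI.
by move=> x [/HI[? _ -> ->] /HJ[_ ? -> ->]].
Qed.

Lemma germ_eq_dom p q :
  (forall x, bdom p x -> bdom q x ->
     lact p x = lact q x /\ ract p x = ract q x) -> germ_eq p q.
Proof.
move=> H; exists (bdom p `&` bdom q); first by apply: nzidealI; apply: bdomP.
by move=> x [px qx]; case: (H x px qx).
Qed.

Definition germb : rel (bimult R) := fun p q => `[< germ_eq p q >].

Lemma germb_equiv : equiv_class_of germb.
Proof.
split.
- by move=> p; apply/asboolP; apply: germ_eq_refl.
- by move=> p q; apply/asboolP/asboolP; apply: germ_eq_sym.
- by move=> q p r /asboolP pq /asboolP qr; apply/asboolP/(germ_eq_trans pq).
Qed.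

Fact bimult0_ax : bimult_axiom (@setT R) (fun=> 0) (fun=> 0).
Proof.
by split; [exact: nzideal_setT|..]; move=> *; rewrite ?addr0 ?rmul0r ?rmulr0.
Qed.
Definition bimult0 := Bimult bimult0_ax.

Fact bimult1_ax : bimult_axiom (@setT R) id id.
Proof. by split=> //; exact: nzideal_setT. Qed.
Definition bimult1 := Bimult bimult1_ax.

Fact bimult_inj_ax a :
  bimult_axiom (@setT R) (fun x => a ** x) (fun x => x ** a).
Proof.
by split; [exact: nzideal_setT|..]; move=> *; rewrite ?rmulDl ?rmulDr ?rmulA.
Qed.
Definition bimult_inj a := Bimult (bimult_inj_ax a).

Fact bimult_opp_ax p :
  bimult_axiom (bdom p) (fun x => - lact p x) (fun x => - ract p x).
Proof.
split=> [|x y px py|x r px|x y px py|r x px|x y px py]; first exact: bdomP.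
- by rewrite lactD // opprD.
- by rewrite lactM // rmulNr.
- by rewrite ractD // opprD.
- by rewrite ractM // rmulrN.
- by rewrite rmulNr rmulrN bimultP.
Qed.
Definition bimult_opp p := Bimult (bimult_opp_ax p).

Fact bimult_add_ax p q : bimult_axiom (bdom p `&` bdom q)
  (fun x => lact p x + lact q x) (fun x => ract p x + ract q x).
Proof.
split=> [|x y [? ?] [? ?]|x r [? ?]|x y [? ?] [? ?]|r x [? ?]|x y [? ?] [? ?]].
- by apply: nzidealI; apply: bdomP.
- by rewrite !lactD // addrACA.
- by rewrite !lactM // rmulDl.
- by rewrite !ractD // addrACA.
- by rewrite !ractM // rmulDr.
- by rewrite rmulDl rmulDr !bimultP.
Qed.
Definition bimult_add p q := Bimult (bimult_add_ax p q).

Lemma setmul_act p q (I J : set R) x : ideal I -> ideal J ->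
    I `<=` bdom p -> J `<=` bdom q -> setmul J I x ->
  [/\ I x, J x, I (lact q x) & J (ract p x)].
Proof.
move=> iI iJ Ip Jq JIx.
suff [Iq Jp] : I (lact q x) /\ J (ract p x).
  by split=> //; [apply: setmul_subr JIx|apply: setmul_subl JIx].
have := JIx; suff: setmul J I `<=`
  [set z | [/\ I z, J z & I (lact q z) /\ J (ract p z)]] by move/[apply] => -[].
have [[sI lI rI] [sJ lJ rJ]] := (iI, iJ).
apply: addspan_min => [|_ [y Jy [z Iz <-]]].
  split=> /= [|y z].
    by rewrite lact0 ract0; case: sI sJ => ? _ [? _].
  move=> [Iy Jy [? ?]] [Iz Jz [? ?]].
  have [[_ BI] [_ BJ]] := (sI, sJ).
  split; [exact: BI|exact: BJ|].
  have [qy qz pY pz] : [/\ bdom q y, bdom q z, bdom p y & bdom p z].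
    by split; auto.
  rewrite lactD ?ractD ?lactN ?ractN //; try exact: bdomN.
  by split; [apply: BI|apply: BJ].
have qy := Jq _ Jy; have pz := Ip _ Iz.
split; [exact: lI|exact: rJ|].
by rewrite lactM // ractM //; split; [apply: lI|apply: rJ].
Qed.

Lemma bimult_mulP p q x : setmul (bdom q) (bdom p) x ->
  [/\ bdom p x, bdom q x, bdom p (lact q x) & bdom q (ract p x)].
Proof. by apply: setmul_act => //; apply: bdom_ideal. Qed.

Fact bimult_mul_ax p q : bimult_axiom (setmul (bdom q) (bdom p))
  (fun x => lact p (lact q x)) (fun x => ract q (ract p x)).
Proof.
split; first by apply: nzideal_setmul; apply: bdomP.
- by move=> x y /bimult_mulP[? ? ? ?] /bimult_mulP[? ? ? ?]; rewrite !lactD.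
- by move=> x r /bimult_mulP[? ? ? ?]; rewrite !lactM.
- by move=> x y /bimult_mulP[? ? ? ?] /bimult_mulP[? ? ? ?]; rewrite !ractD.
- by move=> r x /bimult_mulP[? ? ? ?]; rewrite !ractM.
- move=> x y /bimult_mulP[? ? ? ?] /bimult_mulP[? ? ? ?].
  by rewrite bimultP // bimultP.
Qed.
(* On the ideal bdom q * bdom p, lact q takes its values in bdom p and
   ract p takes its values in bdom q. *)
Definition bimult_mul p q := Bimult (bimult_mul_ax p q).

Lemma bimult_opp_eq p p' :
  germ_eq p p' -> germ_eq (bimult_opp p) (bimult_opp p').
Proof. by case=> I nI H; exists I => // x /H[? ? /= -> ->]. Qed.

Lemma bimult_add_eq p p' q q' : germ_eq p p' -> germ_eq q q' ->
  germ_eq (bimult_add p q) (bimult_add p' q').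
Proof.
move=> [I nI HI] [J nJ HJ]; exists (I `&` J); first exact: nzidealI.
by move=> x [/HI[? ? e1 e2] /HJ[? ? e3 e4]]; rewrite /= e1 e2 e3 e4; do !split.
Qed.

Lemma bimult_mul_eq p p' q q' : germ_eq p p' -> germ_eq q q' ->
  germ_eq (bimult_mul p q) (bimult_mul p' q').
Proof.
move=> [I nI HI] [J nJ HJ]; exists (setmul J I); first exact: nzideal_setmul.
have [iI iJ] := (nI.1, nJ.1).
have sm (A B C D : set R) : A `<=` C -> B `<=` D -> setmul A B `<=` setmul C D.
  move=> AC BD; apply: addspan_min => [|_ [a Aa [b Bb <-]]].
    exact: addspan_subgroup.
  by apply: setmul_gen; [apply: AC|apply: BD].
move=> x JIx /=; split.
- by apply: sm JIx => y; [case/HJ|case/HI].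
- by apply: sm JIx => y; [case/HJ|case/HI].
- have [||Ix Jx Iq Jp] := @setmul_act p q I J x iI iJ _ _ JIx;
    [by move=> y /HI[]| |].
    by move=> y /HJ[].
  by have [_ _ <- _] := HJ _ Jx; have [_ _ -> _] := HI _ Iq.
- have [||Ix Jx Iq Jp] := @setmul_act p q I J x iI iJ _ _ JIx;
    [by move=> y /HI[]| |].
    by move=> y /HJ[].
  by have [_ _ _ <-] := HI _ Ix; have [_ _ _ ->] := HJ _ Jp.
Qed.

Lemma bimult_mulDl p q r : germ_eq (bimult_mul (bimult_add p q) r)
  (bimult_add (bimult_mul p r) (bimult_mul q r)).
Proof.
apply: germ_eq_dom => x _ [/bimult_mulP[_ _ _ ?] /bimult_mulP[_ _ _ ?]] /=.
by rewrite ractD.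
Qed.

Lemma bimult_mulDr p q r : germ_eq (bimult_mul p (bimult_add q r))
  (bimult_add (bimult_mul p q) (bimult_mul p r)).
Proof.
apply: germ_eq_dom => x _ [/bimult_mulP[_ _ ? _] /bimult_mulP[_ _ ? _]] /=.
by rewrite lactD.
Qed.

End BimultOps.

Canonical germb_equiv_rel (R : primeRngType) := EquivRelPack (@germb_equiv R).

(* The Martindale symmetric ring of quotients. *)
Definition Qs (R : primeRngType) := {eq_quot (@germb R)}%qT.

HB.instance Definition _ (R : primeRngType) := Choice.on (Qs R).
HB.instance Definition _ (R : primeRngType) := EqQuotient.on (Qs R).

Section QsRing.
Variable R : primeRngType.
Implicit Types (p q : bimult R) (u v w : Qs R).

Lemma QsP p q : reflect (germ_eq p q) (\pi_(Qs R) p == \pi_(Qs R) q).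
Proof. by rewrite eqmodE; apply: asboolP. Qed.

Lemma Qs_eq p q : germ_eq p q -> \pi_(Qs R) p = \pi_(Qs R) q.
Proof. by move=> H; apply/eqP/QsP. Qed.

Lemma germ_eq_repr p : germ_eq (repr (\pi_(Qs R) p)) p.
Proof. by apply/QsP; rewrite reprK. Qed.

Lemma Qs_surj u : exists p, u = \pi_(Qs R) p.
Proof. by exists (repr u); rewrite reprK. Qed.

Definition Qs_opp u : Qs R := \pi_(Qs R) (bimult_opp (repr u)).
Definition Qs_add u v : Qs R := \pi_(Qs R) (bimult_add (repr u) (repr v)).
Definition Qs_mul u v : Qs R := \pi_(Qs R) (bimult_mul (repr u) (repr v)).

Lemma Qs_oppE p : Qs_opp (\pi_(Qs R) p) = \pi_(Qs R) (bimult_opp p).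
Proof. exact/Qs_eq/bimult_opp_eq/germ_eq_repr. Qed.

Lemma Qs_addE p q : Qs_add (\pi_(Qs R) p) (\pi_(Qs R) q) =
  \pi_(Qs R) (bimult_add p q).
Proof. by apply/Qs_eq/bimult_add_eq; apply: germ_eq_repr. Qed.

Lemma Qs_mulE p q : Qs_mul (\pi_(Qs R) p) (\pi_(Qs R) q) =
  \pi_(Qs R) (bimult_mul p q).
Proof. by apply/Qs_eq/bimult_mul_eq; apply: germ_eq_repr. Qed.

Lemma Qs_addA : associative Qs_add.
Proof.
move=> u v w.
have [[[p ->] [q ->]] [r ->]] := (Qs_surj u, Qs_surj v, Qs_surj w).
by rewrite !Qs_addE; apply/Qs_eq/germ_eq_dom => x _ _ /=; rewrite !addrA.
Qed.

Lemma Qs_addC : commutative Qs_add.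
Proof.
move=> u v; have [[p ->] [q ->]] := (Qs_surj u, Qs_surj v); rewrite !Qs_addE.
apply/Qs_eq/germ_eq_dom => x _ _ /=.
by split; apply: addrC.
Qed.

Lemma Qs_add0 : left_id (\pi_(Qs R) (bimult0 R)) Qs_add.
Proof.
move=> u; have [p ->] := Qs_surj u; rewrite !Qs_addE.
by apply/Qs_eq/germ_eq_dom => x _ _ /=; rewrite !add0r.
Qed.

Lemma Qs_addN : left_inverse (\pi_(Qs R) (bimult0 R)) Qs_opp Qs_add.
Proof.
move=> u; have [p ->] := Qs_surj u; rewrite Qs_oppE Qs_addE.
by apply/Qs_eq/germ_eq_dom => x _ _ /=; rewrite !addNr.
Qed.

HB.instance Definition _ :=
  GRing.isZmodule.Build (Qs R) Qs_addA Qs_addC Qs_add0 Qs_addN.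

Lemma Qs_mulA : associative Qs_mul.
Proof.
move=> u v w.
have [[[p ->] [q ->]] [r ->]] := (Qs_surj u, Qs_surj v, Qs_surj w).
by rewrite !Qs_mulE; apply/Qs_eq/germ_eq_dom.
Qed.

Lemma Qs_mul1 : left_id (\pi_(Qs R) (bimult1 R)) Qs_mul.
Proof.
move=> u; have [p ->] := Qs_surj u.
by rewrite Qs_mulE; apply/Qs_eq/germ_eq_dom.
Qed.

Lemma Qs_mulr1 : right_id (\pi_(Qs R) (bimult1 R)) Qs_mul.
Proof.
move=> u; have [p ->] := Qs_surj u.
by rewrite Qs_mulE; apply/Qs_eq/germ_eq_dom.
Qed.

Lemma Qs_mulDl : left_distributive Qs_mul Qs_add.
Proof.
move=> u v w.
have [[[p ->] [q ->]] [r ->]] := (Qs_surj u, Qs_surj v, Qs_surj w).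
by rewrite Qs_addE !Qs_mulE Qs_addE; apply/Qs_eq/bimult_mulDl.
Qed.

Lemma Qs_mulDr : right_distributive Qs_mul Qs_add.
Proof.
move=> u v w.
have [[[p ->] [q ->]] [r ->]] := (Qs_surj u, Qs_surj v, Qs_surj w).
by rewrite Qs_addE !Qs_mulE Qs_addE; apply/Qs_eq/bimult_mulDr.
Qed.

Lemma Qs_1neq0 : \pi_(Qs R) (bimult1 R) != 0 :> Qs R.
Proof.
apply/negP => /QsP[I [_ [x Ix x0]] H].
by case: (H x Ix) => _ _ /= e; rewrite e eqxx in x0.
Qed.

HB.instance Definition _ := GRing.Zmodule_isNzRing.Build (Qs R)
  Qs_mulA Qs_mul1 Qs_mulr1 Qs_mulDl Qs_mulDr Qs_1neq0.

Definition Qs_inj (a : R) : Qs R := \pi_(Qs R) (bimult_inj a).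

Lemma Qs_injD a b : Qs_inj (a + b) = Qs_inj a + Qs_inj b.
Proof.
rewrite [RHS]Qs_addE; apply/Qs_eq/germ_eq_dom => x _ _ /=.
by rewrite rmulDl rmulDr.
Qed.

Lemma Qs_injM a b : Qs_inj (a ** b) = Qs_inj a * Qs_inj b.
Proof.
by rewrite [RHS]Qs_mulE; apply/Qs_eq/germ_eq_dom => x _ _ /=; rewrite !rmulA.
Qed.

Lemma Qs_inj_inj : injective Qs_inj.
Proof.
move=> a b /eqP/QsP[I nI H]; apply/eqP; rewrite -subr_eq0; apply/eqP.
apply: (nzideal_annl nI) => x Ix; case: (H x Ix) => _ _ /= e _.
by rewrite rmulBl e subrr.
Qed.

Lemma Qs_lactE p x : bdom p x -> \pi_(Qs R) p * Qs_inj x = Qs_inj (lact p x).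
Proof.
move=> px; rewrite [LHS]Qs_mulE; apply/Qs_eq/germ_eq_dom.
by move=> y /bimult_mulP[py _ _ _] _ /=; rewrite lactM // bimultP.
Qed.

Lemma Qs_ractE p x : bdom p x -> Qs_inj x * \pi_(Qs R) p = Qs_inj (ract p x).
Proof.
move=> px; rewrite [LHS]Qs_mulE; apply/Qs_eq/germ_eq_dom.
by move=> y /bimult_mulP[_ py _ _] _ /=; rewrite ractM // bimultP.
Qed.

Lemma Qs_bounded u : exists2 I : set R, nzideal I &
  forall x, I x -> (exists y, u * Qs_inj x = Qs_inj y) /\
                   (exists y, Qs_inj x * u = Qs_inj y).
Proof.
have [p ->] := Qs_surj u; exists (bdom p) => [|x px]; first exact: bdomP.
split; first by exists (lact p x); apply: Qs_lactE.
by exists (ract p x); apply: Qs_ractE.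
Qed.

Lemma Qs_annl u (I : set R) : nzideal I ->
  (forall x, I x -> u * Qs_inj x = 0) -> u = 0.
Proof.
move=> nI; have [p ->] := Qs_surj u => H; set J := I `&` bdom p.
have nJ : nzideal J by apply: nzidealI => //; apply: bdomP.
have Qs_inj0 : Qs_inj 0 = 0.
  by apply: (addrI (Qs_inj 0)); rewrite -Qs_injD !addr0.
have l0 x : J x -> lact p x = 0.
  by case=> Ix px; apply: Qs_inj_inj; rewrite -Qs_lactE // H // Qs_inj0.
apply: Qs_eq; exists J => // x Jx; have [_ px] := Jx.
split=> //=; first exact: l0.
by apply: (nzideal_annl nJ) => y Jy; rewrite bimultP ?l0 ?rmulr0 //; case: Jy.
Qed.

Lemma Qs_annr u (I : set R) : nzideal I ->
  (forall x, I x -> Qs_inj x * u = 0) -> u = 0.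
Proof.
move=> nI; have [p ->] := Qs_surj u => H; set J := I `&` bdom p.
have nJ : nzideal J by apply: nzidealI => //; apply: bdomP.
have Qs_inj0 : Qs_inj 0 = 0.
  by apply: (addrI (Qs_inj 0)); rewrite -Qs_injD !addr0.
have r0 x : J x -> ract p x = 0.
  by case=> Ix px; apply: Qs_inj_inj; rewrite -Qs_ractE // H // Qs_inj0.
apply: Qs_eq; exists J => // x Jx; have [_ px] := Jx.
split=> //=; last exact: r0.
by apply: (nzideal_annr nJ) => y Jy; rewrite -bimultP ?r0 ?rmul0r //; case: Jy.
Qed.

Definition extcentroid : set (Qs R) := [set c | forall u, c * u = u * c].

Definition Cspan (A : set R) : set (Qs R) :=
  addspan [set c * Qs_inj x | c in extcentroid & x in A].

Definition Cline1 (a : R) : set (Qs R) :=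
  [set b * Qs_inj a + c | b in extcentroid & c in extcentroid].

End QsRing.

(* Main.v *)
(* If a in K and b in L do not commute, then
   x[a,b][b,y] = [a,xb][b,y] - [a,x][b,by] lies in KL for all x and y; as KL is
   a Lie ideal, it contains the ideal R[a,b][b,R]R, which is nonzero by
   primeness, and multiplying a nonzero ideal by a nonzero Lie ideal on either
   side gives a nonzero ideal.  Otherwise each K_j commutes with K_(j+1).  When
   K and L commute, [a,[b,xy]] = 0 yields [b,x]z[a,y] = -[a,x]z[b,y], so by
   Martindale's argument ad b is a C-multiple of ad a and L is contained in
   Ca + C.  By symmetry K is contained in Cb + C for each noncentral b in L, so
   Ca + C = Cb + C and both K and L are commutative.  Finally KC = Ca + C, as
   otherwise [a,R] would lie in Ca, which primeness rules out. *)

Require Import Defs.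
From mathcomp Require Import all_boot all_algebra.
From mathcomp Require Import boolp classical_sets.

Set Implicit Arguments.
Unset Strict Implicit.

Import GRing.Theory.
Local Open Scope classical_set_scope.
Local Open Scope ring_scope.

Lemma addsubgroupB (V : zmodType) (A : set V) x y :
  addsubgroup A -> A x -> A y -> A (x - y).
Proof. by case=> _ AB; apply: AB. Qed.

Definition bracket (R : rngType) (x y : R) : R := x ** y - y ** x.

(** * Products of ideals and Lie ideals in an arbitrary ring *)

Section LieIdeals.
Variable R : rngType.
Implicit Types (A B K L : set R) (a b x y z : R).

Lemma bracketxx x : bracket x x = 0.
Proof. exact: subrr. Qed.

Lemma bracketMr a x y :
  bracket a (x ** y) = bracket a x ** y + x ** bracket a y.
Proof. by rewrite /bracket rmulBl rmulBr !rmulA addrA subrK. Qed.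

Lemma bracketMl x y a :
  bracket (x ** y) a = x ** bracket y a + bracket x a ** y.
Proof. by rewrite /bracket rmulBl rmulBr !rmulA addrA subrK. Qed.

Lemma bracketBl x y a : bracket (x - y) a = bracket x a - bracket y a.
Proof. by rewrite /bracket rmulBl rmulBr !opprD addrACA. Qed.

Lemma lie_idealP K :
  lie_ideal K <->
  addsubgroup K /\ forall a x, K a -> K (bracket a x).
Proof.
split=> -[sK brK]; split=> //.
  by move=> a x Ka; apply: brK; apply: sub_addspan; exists a => //; exists x.
by apply: addspan_min => // _ [a Ka [x _ <-]]; apply: brK.
Qed.

Lemma lie_ideal_setmul K L : lie_ideal K -> lie_ideal L ->
  lie_ideal (setmul K L).
Proof.
move=> /lie_idealP[_ brK] /lie_idealP[_ brL].
have sKL : addsubgroup (setmul K L) by apply: addspan_subgroup.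
apply/lie_idealP; split=> // u x; move: u.
suff : setmul K L `<=` [set u | setmul K L (bracket u x)] by [].
apply: addspan_min => [|_ [a Ka [b Lb <-]] /=].
  split=> /= [|u v Wu Wv].
    by rewrite /bracket rmul0r rmulr0 subrr; case: sKL.
  by rewrite bracketBl; apply: (addsubgroupB sKL).
rewrite bracketMl; apply: (addsubgroupD sKL); apply: setmul_gen => //.
  exact: brL.
exact: brK.
Qed.

Lemma setmulS A A' B B' : A `<=` A' -> B `<=` B' ->
  setmul A B `<=` setmul A' B'.
Proof.
move=> AA' BB'; apply: addspan_min => [|_ [x Ax [y By <-]]].
  exact: addspan_subgroup.
by apply: setmul_gen; [apply: AA'|apply: BB'].
Qed.

Lemma setmulA_sub A B D :
  setmul A (setmul B D) `<=` setmul (setmul A B) D.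
Proof.
have sABD : addsubgroup (setmul (setmul A B) D) by apply: addspan_subgroup.
apply: addspan_min => // _ [a Aa [u BDu <-]]; move: u BDu.
suff : setmul B D `<=` [set u | setmul (setmul A B) D (a ** u)] by [].
apply: addspan_min => [|_ [b Bb [d Dd <-]] /=].
  split=> /= [|u v Wu Wv]; first by rewrite rmulr0; case: sABD.
  by rewrite rmulBr; apply: (addsubgroupB sABD).
by rewrite rmulA; do 2!apply: setmul_gen => //.
Qed.

(** The identity i l r = (i r) l + i [l, r] moves a right multiplier past L. *)
Lemma ideal_setmul_lie I L : ideal I -> lie_ideal L -> ideal (setmul I L).
Proof.
move=> [_ lI rI] /lie_idealP[_ brL].
have sIL : addsubgroup (setmul I L) by apply: addspan_subgroup.
split=> // [r x|x r]; move: x.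
- suff : setmul I L `<=` [set x | setmul I L (r ** x)] by [].
  apply: addspan_min => [|_ [i Ii [l Ll <-]] /=].
    split=> /= [|u v Wu Wv]; first by rewrite rmulr0; case: sIL.
    by rewrite rmulBr; apply: (addsubgroupB sIL).
  by rewrite rmulA; apply: setmul_gen => //; apply: lI.
- suff : setmul I L `<=` [set x | setmul I L (x ** r)] by [].
  apply: addspan_min => [|_ [i Ii [l Ll <-]] /=].
    split=> /= [|u v Wu Wv]; first by rewrite rmul0r; case: sIL.
    by rewrite rmulBl; apply: (addsubgroupB sIL).
  have -> : i ** l ** r = i ** r ** l + i ** bracket l r.
    by rewrite /bracket rmulBr !rmulA addrC subrK.
  apply: (addsubgroupD sIL); apply: setmul_gen => //; first exact: rI.
  exact: brL.
Qed.

(** The identity r l i = l (r i) - [l, r] i moves a left multiplier past L. *)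
Lemma ideal_lie_setmul I L : ideal I -> lie_ideal L -> ideal (setmul L I).
Proof.
move=> [_ lI rI] /lie_idealP[sL brL].
have sLI : addsubgroup (setmul L I) by apply: addspan_subgroup.
split=> // [r x|x r]; move: x.
- suff : setmul L I `<=` [set x | setmul L I (r ** x)] by [].
  apply: addspan_min => [|_ [l Ll [i Ii <-]] /=].
    split=> /= [|u v Wu Wv]; first by rewrite rmulr0; case: sLI.
    by rewrite rmulBr; apply: (addsubgroupB sLI).
  have -> : r ** (l ** i) = l ** (r ** i) - bracket l r ** i.
    by rewrite /bracket rmulBl !rmulA opprB addrC subrK.
  apply: (addsubgroupB sLI); apply: setmul_gen => //; first exact: lI.
  exact: brL.
- suff : setmul L I `<=` [set x | setmul L I (x ** r)] by [].
  apply: addspan_min => [|_ [l Ll [i Ii <-]] /=].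
    split=> /= [|u v Wu Wv]; first by rewrite rmul0r; case: sLI.
    by rewrite rmulBl; apply: (addsubgroupB sLI).
  by rewrite -rmulA; apply: setmul_gen => //; apply: rI.
Qed.

Lemma bracket_sandwich_setmul K L a b x y :
  lie_ideal K -> lie_ideal L -> K a -> L b ->
  setmul K L (x ** (bracket a b ** bracket b y)).
Proof.
move=> /lie_idealP[_ brK] /lie_idealP[_ brL] Ka Lb.
(* Since [b, b y] = b [b, y], the terms [a, x] b [b, y] on the right cancel. *)
have -> : x ** (bracket a b ** bracket b y) =
    bracket a (x ** b) ** bracket b y - bracket a x ** bracket b (b ** y).
  rewrite !bracketMr bracketxx rmul0r add0r.
  by rewrite [in RHS]rmulDl !rmulA addrAC subrr add0r.
have sKL : addsubgroup (setmul K L) by apply: addspan_subgroup.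
apply: (addsubgroupB sKL).
  by apply: setmul_gen; [apply: brK|apply: brL].
by apply: setmul_gen; [apply: brK|apply: brL].
Qed.

End LieIdeals.

(** * Nonzero ideals built from Lie ideals of a prime ring *)

Section PrimeLieIdeals.
Variable R : primeRngType.
Implicit Types (K L P : set R) (a b x y z : R).

Lemma noncentralP K : noncentral K -> exists2 a, K a & ~ center a.
Proof. by move=> /existsNP[a /not_implyP[Ka nca]]; exists a. Qed.

Lemma notcenterP a : ~ center a -> exists x, bracket a x != 0.
Proof.
by move=> /existsNP[x /eqP ax]; exists x; rewrite /bracket subr_eq0.
Qed.

Lemma noncentral_neq0 K : noncentral K -> exists2 a, K a & a != 0.
Proof.
move=> /noncentralP[a Ka nca]; exists a => //; apply/eqP => a0; apply: nca.
by rewrite a0 => x; rewrite rmul0r rmulr0.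
Qed.

(** If p L = 0, then expanding p [b, r x] = p [b, r] x + p r [b, x] leaves p r [b, x] = 0 for every
    r, against primeness. *)
Lemma neq0_noncentral_mul p L : p != 0 -> lie_ideal L -> noncentral L ->
  exists2 l, L l & p ** l != 0.
Proof.
move=> p0 /lie_idealP[_ brL] /noncentralP[b Lb /notcenterP[x bx]].
apply: contrapT => pL.
have pL0 l : L l -> p ** l = 0.
  by move=> Ll; apply/eqP/negPn/negP => pl; apply: pL; exists l.
have: forall r, p ** r ** bracket b x = 0.
  move=> r; have := pL0 _ (brL b (r ** x) Lb).
  by rewrite bracketMr rmulDr !rmulA pL0 ?rmul0r ?add0r //; apply: brL.
by case/rprime => e; [rewrite e eqxx in p0|rewrite e eqxx in bx].
Qed.

Lemma nzideal_setmul_lie I L : nzideal I -> lie_ideal L -> noncentral L ->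
  nzideal (setmul I L).
Proof.
move=> [iI [i Ii i0]] lL ncL; split; first exact: ideal_setmul_lie.
have [l Ll il] := neq0_noncentral_mul i0 lL ncL.
by exists (i ** l) => //; apply: setmul_gen.
Qed.

(** If P I = 0, then p annihilates the nonzero ideal I. Asking only for a nonzero element of P lets
    the lemma apply to partial products of the K_j, for which noncentrality is not established. *)
Lemma nzideal_lie_setmul I P p : nzideal I -> lie_ideal P -> P p -> p != 0 ->
  nzideal (setmul P I).
Proof.
move=> nI lP Pp p0; split; first by apply: ideal_lie_setmul => //; case: nI.
apply: contrapT => PI; move/eqP: p0; apply.
apply: (nzideal_annl nI) => i Ii; apply/eqP/negPn/negP => pi.
by apply: PI; exists (p ** i) => //; apply: setmul_gen.
Qed.

Lemma nzideal_sub_setmul_lie K L a b :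
    lie_ideal K -> lie_ideal L -> K a -> L b -> bracket a b != 0 ->
  exists2 I, nzideal I & I `<=` setmul K L.
Proof.
move=> lK lL Ka Lb ab0.
have /lie_idealP[sKL brKL] := lie_ideal_setmul lK lL.
(* If all these products vanish, taking y = r a gives [a, b] r [b, a] = 0 for every r. *)
have [y s0] : exists y, bracket a b ** bracket b y != 0.
  apply: contrapT => nex.
  have by0 y : bracket a b ** bracket b y = 0.
    by apply/eqP/negPn/negP => h; apply: nex; exists y.
  have: forall r, bracket a b ** r ** bracket b a = 0.
    move=> r; have := by0 (r ** a).
    by rewrite bracketMr rmulDr !rmulA by0 rmul0r add0r.
  case/rprime => e; first by rewrite e eqxx in ab0.
  by move: ab0; rewrite -oppr_eq0 /bracket opprB -/(bracket b a) e eqxx.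
set s := bracket a b ** bracket b y in s0.
have Ws x : setmul K L (x ** s) by apply: bracket_sandwich_setmul.
clearbody s.
(* x s r differs from (r x) s by a bracket, and KL is a Lie ideal. *)
have Wsr x r : setmul K L (x ** s ** r).
  have -> : x ** s ** r = r ** x ** s + bracket (x ** s) r.
    by rewrite /bracket !rmulA addrC subrK.
  by apply: (addsubgroupD sKL); [apply: Ws|apply: brKL].
(* This is RsR, which need not contain s, as R may have no unit. If it were zero, cancelling R on
   both sides would give s = 0. *)
pose I := addspan [set x ** s ** r | x in @setT R & r in @setT R].
have sI : addsubgroup I by apply: addspan_subgroup.
exists I; last by apply: addspan_min => // _ [x _ [r _ <-]].
split; first split=> // [t u|u t]; try move: u.
- suff : I `<=` [set u | I (t ** u)] by [].
  apply: addspan_min => [|_ [x _ [r _ <-]] /=].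
    split=> /= [|u v Wu Wv]; first by rewrite rmulr0; case: sI.
    by rewrite rmulBr; apply: (addsubgroupB sI).
  by rewrite !rmulA; apply: sub_addspan; exists (t ** x) => //; exists r.
- suff : I `<=` [set u | I (u ** t)] by [].
  apply: addspan_min => [|_ [x _ [r _ <-]] /=].
    split=> /= [|u v Wu Wv]; first by rewrite rmul0r; case: sI.
    by rewrite rmulBl; apply: (addsubgroupB sI).
  rewrite -[_ ** r ** t]rmulA.
  by apply: sub_addspan; exists x => //; exists (r ** t).
- apply: contrapT => nex.
  have xsr0 x r : x ** s ** r = 0.
    apply/eqP/negPn/negP => h; apply: nex; exists (x ** s ** r) => //.
    by apply: sub_addspan; exists x => //; exists r.
  move/eqP: s0; apply; apply: (nzideal_annr (@nzideal_setT R)) => x _.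
  by apply: (nzideal_annl (@nzideal_setT R)) => r _; apply: xsr0.
Qed.

End PrimeLieIdeals.

(** * The extended centroid and commuting Lie ideals *)

Section ExtendedCentroid.
Variable R : primeRngType.
Implicit Types (K L : set R) (a b p q x y z : R) (c d : Qs R).

Lemma Qs_inj0 : Qs_inj (0 : R) = 0.
Proof. by apply: (addrI (Qs_inj 0)); rewrite -Qs_injD !addr0. Qed.

Lemma Qs_injN a : Qs_inj (- a) = - Qs_inj a.
Proof. by apply: (addrI (Qs_inj a)); rewrite -Qs_injD !subrr Qs_inj0. Qed.

Lemma Qs_injB a b : Qs_inj (a - b) = Qs_inj a - Qs_inj b.
Proof. by rewrite Qs_injD Qs_injN. Qed.

Lemma extcentroid0 : extcentroid (0 : Qs R).
Proof. by move=> u; rewrite mul0r mulr0. Qed.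

Lemma extcentroidB c d : extcentroid c -> extcentroid d -> extcentroid (c - d).
Proof. by move=> Cc Cd u; rewrite mulrBl mulrBr Cc Cd. Qed.

Lemma extcentroidM c d : extcentroid c -> extcentroid d -> extcentroid (c * d).
Proof. by move=> Cc Cd u; rewrite -mulrA Cd mulrA Cc mulrA. Qed.

(** For x in an ideal I with v I inside R, u v x = v x u = v u x, so u v - v u annihilates I. *)
Lemma extcentroid_inj u :
  (forall r : R, u * Qs_inj r = Qs_inj r * u) -> extcentroid u.
Proof.
move=> uC v; apply/eqP; rewrite -subr_eq0; apply/eqP.
have [I nI Iv] := Qs_bounded v; apply: (Qs_annl nI) => x Ix.
have [[y vx] _] := Iv _ Ix.
by rewrite mulrBl -!mulrA uC vx uC [v * _]mulrA vx subrr.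
Qed.

(* Martindale's construction of an element of C as the ratio of v to u, where
   (p, q) serves as a witness that the ratio is well defined. *)
Lemma extcentroid_ratio p q (G : R -> R -> Prop) : p != 0 ->
    (forall u v, G u v -> forall z, p ** z ** v = q ** z ** u) ->
    (exists u v, G u v /\ u != 0) ->
  exists2 c, extcentroid c & forall u v, G u v -> c * Qs_inj u = Qs_inj v.
Proof.
move=> p0 pqG [u0 [v0 [Guv0 u0n]]].
(* For a scalar c with q = c p, this relation says v = c u. Unlike [G], it is visibly stable under
   sums and under multiplication by R on both sides. *)
pose ratio u v := forall z, p ** z ** v = q ** z ** u.
have ratio_uniq u v w : ratio u v -> ratio u w -> v = w.
  move=> uv uw; apply/eqP; rewrite -subr_eq0; apply/eqP.
  have: forall z, p ** z ** (v - w) = 0.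
    by move=> z; rewrite rmulBr uv uw subrr.
  by case/rprime => // e; rewrite e eqxx in p0.
have ratioB u v u' v' : ratio u v -> ratio u' v' -> ratio (u - u') (v - v').
  by move=> uv uv' z; rewrite !rmulBr uv uv'.
have ratioD u v u' v' : ratio u v -> ratio u' v' -> ratio (u + u') (v + v').
  by move=> uv uv' z; rewrite !rmulDr uv uv'.
have ratioMr u v r : ratio u v -> ratio (u ** r) (v ** r).
  by move=> uv z; rewrite !rmulA uv.
have ratioMl u v r : ratio u v -> ratio (r ** u) (r ** v).
  by move=> uv z; rewrite !rmulA -![_ ** z ** r]rmulA uv.
pose D := [set u | exists v, ratio u v].
(* The default 0 is taken only outside [D], where values do not affect the germ. *)
pose f u := xget 0 [set v | ratio u v].
have fP u : D u -> ratio u (f u) by move=> Du; apply: xgetPex.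
have fE u v : ratio u v -> f u = v.
  by move=> uv; apply: (@ratio_uniq u) => //; apply: fP; exists v.
have nD : nzideal D.
  split; last by exists u0 => //; exists v0 => z; apply: pqG.
  split; first split.
  - by exists 0 => z; rewrite !rmulr0.
  - by move=> u u' [v uv] [v' uv']; exists (v - v'); apply: ratioB.
  - by move=> r u [v uv]; exists (r ** v); apply: ratioMl.
  - by move=> u r [v uv]; exists (v ** r); apply: ratioMr.
have fD u v : D u -> D v -> f (u + v) = f u + f v.
  by move=> Du Dv; apply/fE/ratioD; apply: fP.
have fMr u r : D u -> f (u ** r) = f u ** r.
  by move=> Du; apply/fE/ratioMr/fP.
have fMl r u : D u -> f (r ** u) = r ** f u.
  by move=> Du; apply/fE/ratioMl/fP.
have fax : bimult_axiom D f f.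
  by split=> // x y Dx Dy; rewrite -fMr // fMl.
pose c : Qs R := \pi_(Qs R)%qT (Bimult fax).
have cE u : D u -> c * Qs_inj u = Qs_inj (f u).
  exact: (@Qs_lactE _ (Bimult fax)).
exists c => [|u v Guv]; last first.
  have uv : ratio u v by move=> z; apply: pqG.
  by rewrite cE ?(fE _ _ uv) //; exists v.
(* On [D], c r x = f (r x) = r f x = r c x. *)
apply: extcentroid_inj => r; apply/eqP; rewrite -subr_eq0; apply/eqP.
apply: (Qs_annl nD) => x Dx.
rewrite mulrBl -!mulrA -Qs_injM !cE // -?Qs_injM ?fMl ?subrr //.
by case: nD => -[_ lD _] _; apply: lD.
Qed.

(** The inverse is the ratio of v to c v, for v in an ideal I with c I inside R. The witness is (c
    x, x) for some x in I not killed by c, since (c x) z v = x z (c v). *)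
Lemma extcentroid_inv c : extcentroid c -> c != 0 ->
  exists2 d, extcentroid d & d * c = 1.
Proof.
move=> Cc c0; have [I nI Ic] := Qs_bounded c.
pose G u v := I v /\ c * Qs_inj v = Qs_inj u.
have [x [y [Gyx y0]]] : exists x y, G y x /\ y != 0.
  apply: contrapT => nex; move/eqP: c0; apply; apply: (Qs_annl nI) => x Ix.
  have [[y cx] _] := Ic _ Ix; rewrite cx.
  have [-> |y0] := eqVneq y 0; first exact: Qs_inj0.
  by case: nex; exists x, y.
have yx u v : G u v -> forall z, y ** z ** v = x ** z ** u.
  case: Gyx => _ cx [_ cv] z; apply: Qs_inj_inj.
  rewrite !Qs_injM -cx -cv (Cc (Qs_inj x)) -!mulrA [c * (_ * _)]mulrA.
  by rewrite Cc -mulrA.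
have [|d Cd dG] := extcentroid_ratio y0 yx; first by exists y, x.
exists d => //; apply/eqP; rewrite -subr_eq0; apply/eqP.
apply: (Qs_annl nI) => v Iv; have [[u cv] _] := Ic _ Iv.
by rewrite mulrBl mul1r -mulrA cv (dG u v) ?subrr.
Qed.

Lemma Qs_inj_bracket a b :
  Qs_inj (bracket a b) = Qs_inj a * Qs_inj b - Qs_inj b * Qs_inj a.
Proof. by rewrite Qs_injB !Qs_injM. Qed.

Lemma Cline1_subgroup a : addsubgroup (Cline1 a).
Proof.
split; first by exists 0; [exact: extcentroid0|exists 0; [exact: extcentroid0|
  rewrite mul0r addr0]].
move=> _ _ [b Cb [c Cc <-]] [b' Cb' [c' Cc' <-]].
exists (b - b'); first exact: extcentroidB.
exists (c - c'); first exact: extcentroidB.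
by rewrite mulrBl opprD addrACA.
Qed.

Lemma Cline1_scale a c u : extcentroid c -> Cline1 a u -> Cline1 a (c * u).
Proof.
move=> Cc [b Cb [d Cd <-]]; exists (c * b); first exact: extcentroidM.
by exists (c * d); [exact: extcentroidM|rewrite mulrDr mulrA].
Qed.

Lemma Cline1_const a c : extcentroid c -> Cline1 a c.
Proof.
move=> Cc; exists 0; first exact: extcentroid0.
by exists c => //; rewrite mul0r add0r.
Qed.

Lemma sub_Cline1 a b : Cline1 b (Qs_inj a) -> Cline1 a `<=` Cline1 b.
Proof.
move=> ba _ [c Cc [d Cd <-]]; apply: addsubgroupD; first exact: Cline1_subgroup.
  exact: Cline1_scale.
exact: Cline1_const.
Qed.

Lemma Cspan_sub_Cline1 L a :
  (forall b, L b -> Cline1 a (Qs_inj b)) -> Cspan L `<=` Cline1 a.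
Proof.
move=> La; apply: addspan_min; first exact: Cline1_subgroup.
by move=> _ [c Cc [b Lb <-]]; apply: Cline1_scale => //; apply: La.
Qed.

Lemma Cline1_commr a u w :
  Cline1 a u -> Qs_inj a * w = w * Qs_inj a -> u * w = w * u.
Proof.
move=> [b Cb [c Cc <-]] aw.
by rewrite mulrDl mulrDr Cc -mulrA aw !mulrA Cb.
Qed.

Lemma Cline1_comm a u v : Cline1 a u -> Cline1 a v -> u * v = v * u.
Proof.
move=> au av; apply: (Cline1_commr au); symmetry.
exact: (Cline1_commr av).
Qed.

Lemma commuting_lie_Cline1 L a b : lie_ideal L -> L b -> ~ center a ->
  (forall l, L l -> bracket a l = 0) -> Cline1 a (Qs_inj b).
Proof.
move=> /lie_idealP[_ brL] Lb nca aL.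
have [x0 ax0] := notcenterP nca.
(* Expand [a, [b, x y]] = 0; the terms containing [a, [b, x]] or [a, [b, y]] vanish. *)
have brD (x y : R) :
    bracket b x ** bracket a y + bracket a x ** bracket b y = 0.
  have := aL _ (brL b (x ** y) Lb).
  have brDr (u v : R) : bracket a (u + v) = bracket a u + bracket a v.
    by rewrite /bracket rmulDl rmulDr opprD addrACA.
  rewrite bracketMr brDr !bracketMr (aL _ (brL b x Lb)) (aL _ (brL b y Lb)).
  by rewrite rmul0r rmulr0 add0r addr0.
(* Put z y for y in [brD]; the terms ending in y cancel by [brD] for x and z. *)
have brDz (x z y : R) :
    bracket a x ** z ** bracket b y = (- bracket b x) ** z ** bracket a y.
  have := brD x (z ** y).
  rewrite !bracketMr (rmulDr (bracket b x)) (rmulDr (bracket a x)) !rmulA.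
  rewrite addrACA -rmulDl brD rmul0r add0r addrC => /eqP.
  by rewrite addr_eq0 !rmulNr => /eqP.
pose G u v := exists y, u = bracket a y /\ v = bracket b y.
have GP u v : G u v ->
    forall z, bracket a x0 ** z ** v = (- bracket b x0) ** z ** u.
  by case=> y [-> ->] z; apply: brDz.
have [|c Cc cG] := extcentroid_ratio ax0 GP.
  by exists (bracket a x0), (bracket b x0); split=> //; exists x0.
exists c => //; exists (Qs_inj b - c * Qs_inj a); last by rewrite addrC subrK.
(* From c [a, r] = [b, r], the element b - c a commutes with R. *)
apply: extcentroid_inj => r; apply/eqP; rewrite -subr_eq0; apply/eqP.
have := cG _ _ (ex_intro _ r (conj erefl erefl)); rewrite !Qs_inj_bracket.
move=> /eqP; rewrite eq_sym -subr_eq0 => /eqP <-.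
by rewrite mulrBl !mulrBr !mulrA (Cc (Qs_inj r)) !opprD addrACA.
Qed.

(* If [a,x] = l_x a with l_x in C for all x, then c = [a,x0] <> 0, with
   l = l_(x0), satisfies [c^2,x0] = 2 l c^2 = l c^2, whence c^2 = 0 and
   cRc = 0. *)
Lemma Cline1_sub_Cspan L a : lie_ideal L -> L a -> ~ center a ->
    (forall l, L l -> bracket a l = 0) ->
  Cline1 a `<=` Cspan L.
Proof.
move=> lL La nca aL; have /lie_idealP[sL brL] := lL.
have line l : L l -> Cline1 a (Qs_inj l).
  by move=> Ll; apply: commuting_lie_Cline1 lL Ll nca aL.
(* If some [a, x] = l a + c has c nonzero, dividing by c expresses every scalar through a and
   [a, x], both in L. *)
have [[x [l [c [Cl Cc brE c0]]]]|nex] := pselect (exists x l c,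
    [/\ extcentroid l, extcentroid c,
        l * Qs_inj a + c = Qs_inj (bracket a x) & c != 0]).
  have [d Cd dc] := extcentroid_inv Cc c0.
  move=> _ [b Cb [e Ce <-]].
  have -> : b * Qs_inj a + e =
      (b - e * d * l) * Qs_inj a + (e * d) * Qs_inj (bracket a x).
    by rewrite -brE mulrDr mulrBl !mulrA -(mulrA e d c) dc mulr1 addrA subrK.
  apply: (addsubgroupD (addspan_subgroup _)).
    apply: sub_addspan; exists (b - e * d * l); last by exists a.
    by apply/extcentroidB/extcentroidM => //; apply: extcentroidM.
  apply: sub_addspan; exists (e * d); first exact: extcentroidM.
  by exists (bracket a x) => //; apply: brL.
exfalso.
have ax x : exists2 l, extcentroid l & Qs_inj (bracket a x) = l * Qs_inj a.
  have [l Cl [c Cc brE]] := line _ (brL a x La); exists l => //.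
  have [c0|c0] := eqVneq c 0; first by rewrite -brE c0 addr0.
  by case: nex; exists x, l, c.
have [x0 c0] := notcenterP nca; have [l Cl] := ax x0.
move: c0; move ax0: (bracket a x0) => c c0 cE.
have brc x : Qs_inj (bracket c x) = l * Qs_inj (bracket a x).
  by rewrite !Qs_inj_bracket cE mulrBr !mulrA (Cl (Qs_inj x)).
(* Since [a, x0 a] = c a, this gives c a = m a, and c = l a turns it into c c = m c. *)
have [m Cm ca] := ax (x0 ** a).
have ccE : Qs_inj (c ** c) = m * Qs_inj c.
  move: ca; rewrite bracketMr bracketxx rmulr0 addr0 ax0 Qs_injM => ca.
  by rewrite Qs_injM {2 3}cE mulrA -Cl -mulrA ca !mulrA Cl.
(* The Leibniz rule gives [c c, x0] = 2 l c c, while c c = m c gives m [c, x0] = m l c = l c c. *)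
have lcc : l * Qs_inj (c ** c) = 0.
  apply: (addrI (l * Qs_inj (c ** c))); rewrite addr0.
  transitivity (Qs_inj (bracket (c ** c) x0)).
    rewrite bracketMl Qs_injD !Qs_injM brc ax0.
    by rewrite !mulrA (Cl (Qs_inj c)).
  rewrite Qs_inj_bracket ccE !mulrA -(Cm (Qs_inj x0)) -!mulrA -mulrBr.
  by rewrite -Qs_inj_bracket brc ax0 !mulrA Cl.
have cc : c ** c = 0.
  apply: Qs_inj_inj; rewrite Qs_inj0.
  have [l0|l0] := eqVneq l 0.
    by case/eqP: c0; apply: Qs_inj_inj; rewrite cE l0 mul0r Qs_inj0.
  have [d _ dl] := extcentroid_inv Cl l0.
  by rewrite -[LHS]mul1r -dl -mulrA lcc mulr0.
(* As c c = 0, c z c = [c, z] c = l [a, z] c; with [a, z] = k a this is k (l a) c = k c c = 0. *)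
have: forall z, c ** z ** c = 0.
  move=> z; have -> : c ** z ** c = bracket c z ** c.
    by rewrite /bracket rmulBl -[z ** c ** c]rmulA cc rmulr0 subr0.
  have [k Ck kE] := ax z; apply: Qs_inj_inj; rewrite Qs_injM brc kE Qs_inj0.
  by rewrite mulrA (Cl k) -(mulrA k) -cE -mulrA -Qs_injM cc Qs_inj0 mulr0.
by case/rprime => e; rewrite e eqxx in c0.
Qed.

Lemma commuting_lie_Cspan K L a :
    lie_ideal K -> lie_ideal L -> noncentral L -> K a -> ~ center a ->
    (forall k l, K k -> L l -> bracket k l = 0) ->
  Cspan K = Cline1 a /\ Cspan L = Cline1 a.
Proof.
move=> lK lL ncL Ka nca KL; have [b Lb ncb] := noncentralP ncL.
have LK l k : L l -> K k -> bracket l k = 0.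
  by move=> Ll Kk; apply/eqP; rewrite -oppr_eq0 /bracket opprB; apply/eqP/KL.
have La l : L l -> Cline1 a (Qs_inj l).
  by move=> Ll; apply: (commuting_lie_Cline1 lL Ll nca) => l' Ll'; apply: KL.
have Kb k : K k -> Cline1 b (Qs_inj k).
  by move=> Kk; apply: (commuting_lie_Cline1 lK Kk ncb) => k' Kk'; apply: LK.
have abE : Cline1 a = Cline1 b.
  by apply/seteqP; split; apply: sub_Cline1; [apply: Kb|apply: La].
(* Ca + C is commutative, so K and L each commute with themselves, as [Cline1_sub_Cspan]
   requires. *)
have brC (u v : R) : Cline1 a (Qs_inj u) -> Cline1 a (Qs_inj v) ->
    bracket u v = 0.
  move=> au av; apply: Qs_inj_inj.
  by rewrite Qs_inj_bracket Qs_inj0 (Cline1_comm au av) subrr.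
have Kline k : K k -> Cline1 a (Qs_inj k) by rewrite abE; apply: Kb.
split; apply/seteqP; split; try exact: Cspan_sub_Cline1.
  by apply: Cline1_sub_Cspan => // k Kk; apply: brC; apply: Kline.
by rewrite abE; apply: Cline1_sub_Cspan => // l Ll; apply: brC; apply: La.
Qed.

End ExtendedCentroid.

(** * Partial products of the K_j *)

Section Product.
Variables (R : primeRngType) (m : nat) (K : nat -> set R).
Hypothesis hK :
  forall j, (1 <= j <= m)%N -> lie_ideal (K j) /\ noncentral (K j).

(** [iota 2 n] runs from 2 to n + 1, so [P n] has the n + 1 factors K_1, ..., K_(n+1). *)
Let P n := setprod (K 1%N) [seq K j | j <- iota 2 n].

Lemma setprodS n : P n.+1 = setmul (P n) (K n.+2).
Proof.
have E : iota 2 n.+1 = iota 2 n ++ [:: n.+2].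
  by have := iotaD 2 n 1; rewrite addn1 => ->.
by rewrite /P E map_cat /setprod foldl_cat.
Qed.

Lemma setprod_lie_neq0 n : (n < m)%N ->
  lie_ideal (P n) /\ exists2 p, P n p & p != 0.
Proof.
elim: n => [|n IHn] nm.
  by have [lK /noncentral_neq0 nK] := @hK 1%N nm.
have [lP [p Pp p0]] := IHn (ltnW nm).
have [lK ncK] := @hK n.+2 nm; rewrite setprodS.
split; first exact: lie_ideal_setmul.
have [k Kk pk] := neq0_noncentral_mul p0 lK ncK.
by exists (p ** k) => //; apply: setmul_gen.
Qed.

(** Each further factor K_j replaces the ideal I by I K_j, which is again a nonzero ideal. *)
Lemma nzideal_sub_setprod n n' : (n <= n' < m)%N ->
  (exists2 I, nzideal I & I `<=` P n) -> exists2 I, nzideal I & I `<=` P n'.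
Proof.
move=> /andP[/subnKC <-]; elim: (n' - n)%N => [|i IHi]; first by rewrite addn0.
rewrite addnS => im nzP; have [I nI IP] := IHi (ltnW im) nzP.
have [lK ncK] := @hK (n + i).+2 im; exists (setmul I (K (n + i).+2)).
  exact: nzideal_setmul_lie.
by rewrite setprodS; apply: setmulS.
Qed.

Lemma nzideal_sub_setprod_pair n a b : (n.+1 < m)%N ->
    K n.+1 a -> K n.+2 b -> bracket a b != 0 ->
  exists2 I, nzideal I & I `<=` P n.+1.
Proof.
move=> nm Ka Kb ab; have [lK1 _] := @hK n.+1 (ltnW nm).
have [lK2 _] := @hK n.+2 nm.
have [I nI IKK] := nzideal_sub_setmul_lie lK1 lK2 Ka Kb ab.
(* For n = 0 the pair is the whole product K_1 K_2. Otherwise the nonzero ideal inside the pair is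
   multiplied on the left by the product of the preceding factors. *)
case: n => [|n] in nm Ka Kb lK1 lK2 IKK *; first by exists I.
have [lP [p Pp p0]] := setprod_lie_neq0 (ltnW (ltnW nm)).
exists (setmul (P n) I); first exact: nzideal_lie_setmul p0.
rewrite !setprodS => x /(setmulS (@subset_refl _ (P n)) IKK).
exact: setmulA_sub.
Qed.

End Product.

Theorem theoremD (R : primeRngType) (m : nat) (K : nat -> set R)
    (hm : (2 <= m)%N)
    (hK : forall j, (1 <= j <= m)%N -> lie_ideal (K j) /\ noncentral (K j)) :
  ~ (forall j, (1 <= j <= m)%N ->
       forall a, K 1%N a -> ~ center a ->
         Cspan (K 1%N) = Cspan (K j) /\ Cspan (K j) = Cline1 a) ->
  exists2 I : set R, nzideal I &
    I `<=` setprod (K 1%N) [seq K j | j <- iota 2 m.-1].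
Proof.
move=> nexc.
(* Either two adjacent factors fail to commute elementwise, or all adjacent pairs commute. *)
have [[n [nm [a [b [Ka Kb ab]]]]]|comm] := pselect (exists n, (n.+1 < m)%N /\
    exists a b, [/\ K n.+1 a, K n.+2 b & bracket a b != 0]).
  apply: (nzideal_sub_setprod hK (n := n.+1)); last first.
    exact: (nzideal_sub_setprod_pair hK nm Ka Kb ab).
  by case: m nm {hm hK nexc} => // m' nm; apply/andP; split.
have {}comm n a b : (n.+1 < m)%N -> K n.+1 a -> K n.+2 b -> bracket a b = 0.
  move=> nm Ka Kb; apply/eqP/negPn/negP => ab.
  by apply: comm; exists n; split=> //; exists a, b.
case: nexc => j jm a Ka nca.
suff CK i : (i < m)%N -> Cspan (K i.+1) = Cline1 a.
  by case: j jm => // j jm; rewrite (CK 0%N) ?(ltnW hm) // CK.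
(* The equality passes along the chain: any noncentral b in K_(i+1) gives K_(i+1)C = Cb + C =
   K_(i+2)C, and K_(i+1)C is Ca + C by induction. The pair K_1, K_2 with a itself starts it. *)
elim: i => [|i IHi] im.
  have [lK1 _] := @hK 1%N im; have [lK2 ncK2] := @hK 2%N hm.
  have [//|-> //] := commuting_lie_Cspan lK1 lK2 ncK2 Ka nca.
  by move=> k l; apply: comm.
have [lKi /noncentralP[b Kb ncb]] := @hK i.+1 (ltnW im).
have [lKi' ncKi'] := @hK i.+2 im.
have [|Ei ->] := commuting_lie_Cspan lKi lKi' ncKi' Kb ncb.
  by move=> k l; apply: comm.
by rewrite -Ei IHi // ltnW.
Qed.
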